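(* Let $(X,d)$ be a metric space and $\ell:X\to[0,+\infty)$ a lower semicontinuous function with $[\ell=0]\neq\emptyset$. For $R>0$ let $v_R$ be as defined below, let $u_0$ be the Perron solution of $(\mathcal{G}_0)$ associated with $\ell$, and let $V$ be as defined below. Then: (i) if $X$ is connected, $v_R\to u_0$ pointwise as $R\to+\infty$; (ii) if $X$ is a complete length space and $\ell$ is continuous, then $\liminf_{R\to0^+}v_R\le V$ pointwise; (iii) if $X$ is a compact length space and $\ell$ is continuous, then $v_R\to V$ uniformly as $R\to0$.
   Context: $[\ell=0]=\{x\in X:\ell(x)=0\}$. For $R>0$ and $x\in X$, $v_R(x)=\inf\{\sum_{i=0}^{k-1}\ell(x_i)d(x_i,x_{i+1}): k\in\mathbb{N},\ \{x_i\}_{i=0}^k\subset X,\ x_0=x,\ x_k\in[\ell=0],\ d(x_i,x_{i+1})<R\text{ for } 0\le i\le k-1\}$. $V(x)=\inf\int_0^T\ell(\gamma(t))\,dt$, the infimum over all $T\ge0$ and $1$-Lipschitz curves $\gamma:[0,T]\to X$ with $\gamma(0)=x$ and $\gamma(T)\in[\ell=0]$. Global slope: $G[u](x)=\sup_{y\neq x}\frac{(u(x)-u(y))_+}{d(x,y)}$ if $u(x)<+\infty$, $G[u](x)=+\infty$ otherwise. A solution of $(\mathcal{G}_0)$ is a lower semicontinuous $u$ with $\inf_Xu=0$ and $G[u]=\ell$ on $X$; the Perron solution $u_0$ is the solution that is pointwise maximal among all solutions (it exists since $[\ell=0]\neq\emptyset$). A length space is a metric space in which the distance between two points is the infimum of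 lengths of curves joining them. *)

(* Defs.v *)
From HB Require Import structures.
From mathcomp Require Import all_boot all_order all_algebra.
From mathcomp Require Import all_classical all_reals all_analysis.
Set Implicit Arguments. Unset Strict Implicit. Unset Printing Implicit Defensive.
Import Order.TTheory GRing.Theory Num.Theory.
Import numFieldNormedType.Exports.
Local Open Scope classical_set_scope.
Local Open Scope ring_scope.

Section MetricDefs.
Variables (R : realType) (X : Type) (d : X -> X -> R).

Definition is_metric : Prop :=
  [/\ forall x y, 0 <= d x y, forall x y, d x y = 0 <-> x = y,
      forall x y, d x y = d y x
    & forall x y z, d x z <= d x y + d y z].

Definition mopen (A : set X) : Prop :=
  forall x, A x -> exists2 e : R, 0 < e & forall y, d x y < e -> A y.

Definition mconnected : Prop :=
  forall A B : set X, mopen A -> mopen B -> A `|` B = setT -> A `&` B = set0 ->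
    A = set0 \/ B = set0.

Definition mcomplete : Prop :=
  forall u : nat -> X,
    (forall e : R, 0 < e -> exists N : nat, forall m n, (N <= m)%N -> (N <= n)%N ->
        d (u m) (u n) < e) ->
    exists x : X, forall e : R, 0 < e -> exists N : nat, forall n, (N <= n)%N -> d (u n) x < e.

Definition mcompact : Prop :=
  forall (I : Type) (U : I -> set X), (forall i, mopen (U i)) -> (forall x, exists i, U i x) ->
    exists (n : nat) (f : nat -> I), forall x, exists2 k, (k < n)%N & U (f k) x.

Definition mlsc (l : X -> R) : Prop :=
  forall x (t : R), t < l x -> exists2 e : R, 0 < e & forall y, d x y < e -> t < l y.

Definition mlsc_e (u : X -> \bar R) : Prop :=
  forall x (t : R), (t%:E < u x)%E -> exists2 e : R, 0 < e & forall y, d x y < e -> (t%:E < u y)%E.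

Definition mcontinuous (l : X -> R) : Prop :=
  forall x (e : R), 0 < e -> exists2 del : R, 0 < del & forall y, d x y < del -> `|l x - l y| < e.

Definition curve_cont (g : R -> X) (a b : R) : Prop :=
  forall t, a <= t <= b -> forall e : R, 0 < e -> exists2 del : R, 0 < del &
    forall s, a <= s <= b -> `|s - t| < del -> d (g s) (g t) < e.

Definition curve_length (g : R -> X) (a b : R) : \bar R :=
  ereal_sup [set y | exists (n : nat) (t : nat -> R),
    [/\ t 0%N = a, t n = b, (forall i, (i < n)%N -> t i <= t i.+1)
      & y = (\sum_(i < n) d (g (t i)) (g (t i.+1)))%:E]].

Definition length_space : Prop :=
  forall x y, (d x y)%:E = ereal_inf [set L | exists (a b : R) (g : R -> X),
    [/\ a <= b, curve_cont g a b, g a = x, g b = y & L = curve_length g a b]].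

Definition vR (l : X -> R) (r : R) (x : X) : \bar R :=
  ereal_inf [set y | exists (k : nat) (p : nat -> X),
    [/\ p 0%N = x, l (p k) = 0, (forall i, (i < k)%N -> d (p i) (p i.+1) < r)
      & y = (\sum_(i < k) l (p i) * d (p i) (p i.+1))%:E]].

Definition lip1 (g : R -> X) (T : R) : Prop :=
  forall s t, 0 <= s <= T -> 0 <= t <= T -> d (g s) (g t) <= `|s - t|.

Definition Vfun (l : X -> R) (x : X) : \bar R :=
  ereal_inf [set y | exists (T : R) (g : R -> X),
    [/\ 0 <= T, lip1 g T, g 0 = x, l (g T) = 0
      & y = (\int[@lebesgue_measure R]_(t in [set t : R | (0 <= t <= T)%R]) (l (g t))%:E)%E]].

(* global slope; sup over y <> x of (u x - u y)_+ / d(x,y), with sup of the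
   empty family taken to be 0 (hence the extra 0 in the set) *)
Definition gslope (u : X -> \bar R) (x : X) : \bar R :=
  if u x == +oo%E then +oo%E else
  ereal_sup ([set 0%E] `|` [set y | exists z, z <> x /\
      y = (maxe (u x - u z) 0 * ((d x z)^-1)%:E)%E]).

Definition is_solution (l : X -> R) (u : X -> \bar R) : Prop :=
  [/\ mlsc_e u, ereal_inf (range u) = 0%E & forall x, gslope u x = (l x)%:E].

Definition is_perron (l : X -> R) (u0 : X -> \bar R) : Prop :=
  is_solution l u0 /\ forall u, is_solution l u -> forall x, (u x <= u0 x)%E.

Definition liminf0 (f : R -> \bar R) : \bar R :=
  ereal_sup [set y | exists2 del : R, 0 < del & y = ereal_inf [set f r | r in [set r | 0 < r < del]]].

End MetricDefs.

(* Main.v *)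
(** Every solution [u] satisfies [u x <= l x * d x y + u y], so it lies below the
    infimum [W] of the costs of all chains, with no bound on the steps; [W] is itself
    a solution, because a cheap chain must leave any ball on which [l] is bounded
    below and pays for the radius. Hence [u0 = W], which is the decreasing limit of
    [v_R] as [R] grows.

    Riemann sums of [l] along a 1-Lipschitz curve are chain costs with small steps,
    so [v_R <= V] for every [R > 0].

    Conversely, on a compact length space every two points are joined by a geodesic
    (an ultrafilter limit of almost isometric parametrizations). Replacing the steps
    of a cheap chain by geodesics costs a factor [1 + kap] as long as [l >= eta], and
    the chain is cut at the first point where [l < eta], which is close to [l = 0].
    This gives [V <= (1 + kap) v_R + M rho] uniformly. *)
Require Import Defs.
From HB Require Import structures.
From mathcomp Require Import all_boot all_order all_algebra.
From mathcomp Require Import all_classical all_reals all_analysis.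
From mathcomp Require Import measurable_realfun ring lra.
Set Implicit Arguments. Unset Strict Implicit. Unset Printing Implicit Defensive.
Import Order.TTheory GRing.Theory Num.Theory.
Import numFieldNormedType.Exports.
Local Open Scope classical_set_scope.
Local Open Scope ring_scope.

(** * Continuous functions on a segment *)

Section RealFunctions.
Context {R : realType}.
Implicit Types (f : R -> R) (a b c T : R).
Local Notation mu := (@lebesgue_measure R).

Definition cont_on f a b := forall t, a <= t <= b -> forall e : R, 0 < e ->
  exists2 del : R, 0 < del &
    forall s, a <= s <= b -> `|s - t| < del -> `|f s - f t| < e.

Lemma cont_on_within f a b :
  cont_on f a b -> {within `[a, b], continuous f}.
Proof.
move=> fc; apply/subspace_continuousP => t /=; rewrite in_itv /= => tab.
apply/cvgrPdist_lt => e e0; have [del del0 H] := fc t tab e e0.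
rewrite near_withinE; near=> s => /=; rewrite in_itv /= => sab.
have st : `|t - s| < del by near: s; exact: (nbhsx_ballx (t : R) del).
by rewrite distrC; apply: H => //; rewrite distrC.
Unshelve. all: by end_near. Qed.

(** Heine-Cantor through near-coverings: the filter [0^'+] of candidate moduli turns the local
    moduli into a common one. *)
Lemma cont_on_unif f a b e : 0 < e -> cont_on f a b ->
  exists2 del : R, 0 < del &
    forall s t, a <= s <= b -> a <= t <= b -> `|s - t| < del -> `|f s - f t| < e.
Proof.
move=> e0 fc.
have /compact_near_coveringP/near_covering_withinP H := @segment_compact R a b.
have := H _ (0^'+ : set_system R)
  (fun del t => forall s, a <= s <= b -> `|s - t| < del -> `|f s - f t| < e) _.
case.
  move=> t /=; rewrite in_itv /= => tab.
  have [del del0 K] := fc t tab _ (divr_gt0 e0 (ltr0n _ 2)).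
  near=> x del' => /=.
  rewrite in_itv /= => xab s sab sx.
  have xt : `|x - t| < del / 2.
    rewrite distrC; near: x.
    by near_simpl; apply: (@nbhsx_ballx _ _ t (del/2)); rewrite divr_gt0.
  have del'2 : del' < del / 2.
    near: del'; apply: nbhs_right_lt; by rewrite divr_gt0.
  have h1 : `|f x - f t| < e / 2 by apply: K => //; apply: lt_trans xt _; lra.
  have h2 : `|f s - f t| < e / 2.
    apply: K => //; have := ler_normD (s - x) (x - t).
    have -> : s - x + (x - t) = s - t by ring.
    by lra.
  have := ler_normB (f s - f t) (f x - f t).
  have -> : f s - f t - (f x - f t) = f s - f x by ring.
  by lra.
move=> del /= del0 K.
(* [K] applies only strictly inside the ball of radius [del], so half of it serves as the
   modulus. *)
exists (del / 2) => [|s t sab tab st]; first by rewrite divr_gt0.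
apply: (K (del / 2)) => //=.
- rewrite /ball_ /= sub0r normrN gtr0_norm ?divr_gt0//; lra.
- by rewrite divr_gt0.
Unshelve. all: by end_near. Qed.

Lemma cont_on_measurable f a b : cont_on f a b ->
  measurable_fun `[a, b] (EFin \o f).
Proof.
move=> /cont_on_within fc; apply/measurable_EFinP.
exact: measurable_realfun.subspace_continuous_measurable_fun.
Qed.

Lemma cont_on_measurable_oc f a b : cont_on f a b ->
  measurable_fun `]a, b] (EFin \o f).
Proof.
move=> /cont_on_measurable; apply: measurable_funS => //.
by apply: subset_itvr; rewrite bnd_simp.
Qed.

Lemma cont_on_sub f a b c e : a <= c -> e <= b -> cont_on f a b -> cont_on f c e.
Proof.
move=> ac eb fc t /andP[ct te] eps eps0.
have [|del del0 H] := fc t _ eps eps0.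
  by rewrite (le_trans ac ct) (le_trans te eb).
exists del => // s /andP[cs se]; apply: H.
by rewrite (le_trans ac cs) (le_trans se eb).
Qed.

Lemma segmentE T : [set t : R | (0 <= t <= T)%R] = `[0, T]%classic.
Proof. by apply/seteqP; split => t /=; rewrite in_itv. Qed.

Lemma integral_segment_split f a b : 0 <= a -> a <= b ->
  (forall t, 0 <= t <= b -> 0 <= f t) -> cont_on f 0 b ->
  (\int[mu]_(t in `[0%R, b]) (f t)%:E =
   \int[mu]_(t in `[0%R, a]) (f t)%:E + \int[mu]_(t in `]a, b]) (f t)%:E)%E.
Proof.
move=> a0 ab f0 fc.
have E : `[0, b]%classic = `[0, a] `|` `]a, b] :> set R.
  by rewrite -itv_bndbnd_setU // bnd_simp.
rewrite E ge0_integral_setU //.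
- by rewrite -E; exact: cont_on_measurable.
- by move=> t; rewrite -E /= in_itv /= => tb; rewrite lee_fin f0.
- apply/disj_setPS => t [] /=; rewrite !in_itv /= => /andP[_ ta] /andP[at' _].
  by move: (le_lt_trans ta at'); rewrite ltxx.
Qed.

Lemma integral_oc_cst a b c : a <= b ->
  (\int[mu]_(t in `]a, b]) c%:E = (c * (b - a))%:E)%E.
Proof.
move=> ab; rewrite (integral_cst mu _ c%:E) //= lebesgue_measure_itv /=.
rewrite lte_fin; case: ltP => // ba.
have -> : a = b by apply/le_anti; rewrite ab ba.
by rewrite subrr mulr0 mule0.
Qed.

Lemma ge0_integral_segment f T : (forall t, 0 <= t <= T -> 0 <= f t) ->
  (0 <= \int[mu]_(t in `[0%R, T]) (f t)%:E)%E.
Proof.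
by move=> f0; apply: integral_ge0 => t /=; rewrite in_itv /= => tT; rewrite lee_fin f0.
Qed.

Lemma integral_oc_le f a b c : a <= b -> cont_on f a b ->
  (forall t, a < t <= b -> 0 <= f t <= c) ->
  (\int[mu]_(t in `]a, b]) (f t)%:E <= (c * (b - a))%:E)%E.
Proof.
move=> ab fc fB; rewrite -integral_oc_cst //; apply: ge0_le_integral => //.
- by move=> t /=; rewrite in_itv /= => /fB /andP[]; rewrite lee_fin.
- exact: cont_on_measurable_oc.
- by move=> t /=; rewrite in_itv /= => /fB /andP[]; rewrite lee_fin.
Qed.

Lemma integral_oc_ge f a b c : a <= b -> cont_on f a b -> 0 <= c ->
  (forall t, a < t <= b -> c <= f t) ->
  ((c * (b - a))%:E <= \int[mu]_(t in `]a, b]) (f t)%:E)%E.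
Proof.
move=> ab fc c0 fB; rewrite -integral_oc_cst //; apply: ge0_le_integral => //.
- exact: cont_on_measurable_oc.
Qed.
End RealFunctions.

(** * Chains and the Perron solution *)

Section Chains.
Context {R : realType} {X : Type} (d : X -> X -> R) (l : X -> R).
Hypotheses (dm : is_metric d) (l0 : forall x, 0 <= l x).
Implicit Types (x y z : X) (p : nat -> X) (k : nat).

Lemma met_ge0 x y : 0 <= d x y. Proof. by case: dm. Qed.
Lemma met_xx x : d x x = 0. Proof. by case: dm => _ H _ _; apply/H. Qed.
Lemma met_sym x y : d x y = d y x. Proof. by case: dm. Qed.
Lemma met_tri y x z : d x z <= d x y + d y z. Proof. by case: dm. Qed.
Lemma met_gt0 x y : x <> y -> 0 < d x y.
Proof.
move=> xy; rewrite lt_neqAle met_ge0 andbT eq_sym; apply/eqP => H.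
by apply: xy; case: dm => _ D _ _; apply/D.
Qed.

Definition chain_cost p k := \sum_(i < k) l (p i) * d (p i) (p i.+1).

Lemma chain_cost_ge0 p k : 0 <= chain_cost p k.
Proof. by apply: sumr_ge0 => i _; rewrite mulr_ge0 ?met_ge0. Qed.

Lemma chain_cost_recl p k :
  chain_cost p k.+1 = l (p 0%N) * d (p 0%N) (p 1%N) + chain_cost (p \o succn) k.
Proof. by rewrite /chain_cost big_ord_recl. Qed.

Definition chain_cons x p i := if i is j.+1 then p j else x.

Definition chain_costs x : set R :=
  [set c | exists (k : nat) (p : nat -> X),
    [/\ p 0%N = x, l (p k) = 0 & c = chain_cost p k]].

(** This is [W]. A real infimum is enough: jumping straight to a zero of [l] is a chain, and costs
    are bounded below by 0. *)
Definition chain_inf x : R := inf (chain_costs x).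

Hypothesis zl : exists z, l z = 0.

Lemma chain_costs_lb0 x : lbound (chain_costs x) 0.
Proof. by move=> c [k [p [_ _ ->]]]; exact: chain_cost_ge0. Qed.

Lemma chain_costs_has_inf x : has_inf (chain_costs x).
Proof.
split; last by exists 0; exact: chain_costs_lb0.
have [z lz] := zl.
by exists (chain_cost (chain_cons x (fun=> z)) 1), 1%N, (chain_cons x (fun=> z)).
Qed.

Lemma chain_inf_ge0 x : 0 <= chain_inf x.
Proof.
by apply: lb_le_inf; [case: (chain_costs_has_inf x) | exact: chain_costs_lb0].
Qed.

Lemma chain_inf_le p k : l (p k) = 0 -> chain_inf (p 0%N) <= chain_cost p k.
Proof.
move=> lk; apply: ge_inf; first by case: (chain_costs_has_inf (p 0%N)).
by exists k, p.
Qed.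

Lemma chain_inf_approx x e : 0 < e -> exists (k : nat) (p : nat -> X),
  [/\ p 0%N = x, l (p k) = 0 & chain_cost p k < chain_inf x + e].
Proof.
move=> e0; have [_ [k [p [px lk ->]]] h] := inf_adherent e0 (chain_costs_has_inf x).
by exists k, p.
Qed.

Lemma chain_inf0 z : l z = 0 -> chain_inf z = 0.
Proof.
move=> lz; apply/le_anti; rewrite chain_inf_ge0 andbT.
by apply: (le_trans (@chain_inf_le (fun=> z) 0%N lz)); rewrite /chain_cost big_ord0.
Qed.

(** Prepend [x] to an almost optimal chain from [y]. This is the bound of the slope of [W] by
    [l]. *)
Lemma chain_inf_step x y : chain_inf x <= l x * d x y + chain_inf y.
Proof.
apply/ler_addgt0Pr => e e0; have [k [p [<- lk h]]] := chain_inf_approx y e0.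
have := @chain_inf_le (chain_cons x p) k.+1 lk.
rewrite chain_cost_recl /= => h2; apply: (le_trans h2).
rewrite -addrA lerD2l; exact: ltW.
Qed.

(* A chain started where [l > m] has to leave that region before reaching
   [l = 0]; until its first exit point it pays at least [m] per unit of length. *)
Lemma chain_cost_exit x rho m p k : 0 <= m ->
  (forall y, d x y < rho -> m < l y) -> d x (p 0%N) < rho -> l (p k) = 0 ->
  exists2 y, rho <= d x y & m * d (p 0%N) y + chain_inf y <= chain_cost p k.
Proof.
move=> m0 H; elim: k p => [|k IH] p xp lk.
  by move: (H _ xp); rewrite lk => /(le_lt_trans m0); rewrite ltxx.
have lp : m <= l (p 0%N) by apply/ltW/H.
have mp : m * d (p 0%N) (p 1%N) <= l (p 0%N) * d (p 0%N) (p 1%N).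
  by rewrite ler_wpM2r ?met_ge0.
(* If the second point is already outside the ball, it is the exit point; otherwise the tail
   provides one, and the triangle inequality through [p 1] accounts for the first step. *)
rewrite chain_cost_recl; have [xp1|xp1] := leP rho (d x (p 1%N)).
  by exists (p 1%N) => //; rewrite lerD //; exact: (@chain_inf_le (p \o succn)).
have [y xy h] := IH (p \o succn) xp1 lk; exists y => //=.
have := ler_wpM2l m0 (met_tri (p 1%N) (p 0%N) y).
move: h => /=; rewrite mulrDr; lra.
Qed.

(** The exit point of an almost optimal chain. Since it is at distance at least [rho], the error [e]
    stays small in the difference quotient. *)
Lemma chain_inf_exit x rho m e : 0 <= m -> 0 < rho -> 0 < e ->
  (forall y, d x y < rho -> m < l y) ->
  exists2 y, rho <= d x y & m * d x y + chain_inf y <= chain_inf x + e.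
Proof.
move=> m0 rho0 e0 H; have [k [p [px lk h]]] := chain_inf_approx x e0.
have [|y xy h2] := @chain_cost_exit x rho m p k m0 H _ lk.
  by rewrite px met_xx.
by exists y => //; rewrite -{1}px; apply: (le_trans h2); exact: ltW.
Qed.

Lemma chain_inf_lsc : mlsc_e d (EFin \o chain_inf).
Proof.
move=> x t /=; rewrite lte_fin => tx.
(* [l x] may vanish, hence the shift by 1 in the denominator of the radius. *)
have lx : 0 < l x + 1 by rewrite ltr_wpDl.
exists ((chain_inf x - t) / (l x + 1)); first by rewrite divr_gt0 ?subr_gt0.
move=> y; rewrite ltr_pdivlMr // => xy; rewrite lte_fin.
have := chain_inf_step x y; have := met_ge0 x y; lra.
Qed.

Lemma gslope_chain_inf_le x : (gslope d (EFin \o chain_inf) x <= (l x)%:E)%E.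
Proof.
rewrite /gslope /=; apply: ge_ereal_sup => _ [->|[z [zx ->]]]; first by rewrite lee_fin.
have dxz : 0 < d x z by apply: met_gt0 => xz; apply: zx.
rewrite -EFinB -EFin_max -EFinM lee_fin ler_pdivrMr //.
rewrite ge_max; apply/andP; split; last by rewrite mulr_ge0 ?met_ge0.
rewrite lerBlDr; exact: chain_inf_step.
Qed.

(** If the slope [s] were below [l x], semicontinuity would give a ball where [l > m > s], and the
    exit point of that ball would have a difference quotient above [s]. *)
Lemma gslope_chain_inf_ge x : mlsc d l ->
  ((l x)%:E <= gslope d (EFin \o chain_inf) x)%E.
Proof.
move=> llsc; have := gslope_chain_inf_le x.
have : (0 <= gslope d (EFin \o chain_inf) x)%E.
  by rewrite /gslope /=; apply: ereal_sup_ubound; left.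
case E : (gslope d _ x) => [s| |] //; rewrite !lee_fin => s0 sl.
rewrite leNgt; apply/negP => {}sl.
pose m := (s + l x) / 2.
have ml : m < l x by rewrite /m; lra.
have sm : s < m by rewrite /m; lra.
have [rho rho0 H] := llsc x m ml.
(* This error is less than [(m - s) * d x y] as soon as [rho <= d x y]. *)
have e0 : 0 < rho * (m - s) / 2 by rewrite divr_gt0 // mulr_gt0 ?subr_gt0.
have [y xy h] := chain_inf_exit (le_trans s0 (ltW sm)) rho0 e0 H.
have dxy : 0 < d x y by exact: lt_le_trans xy.
suff : ((chain_inf x - chain_inf y) / d x y <= s).
  rewrite ler_pdivrMr // => h2.
  have h3 : rho * (m - s) / 2 < d x y * (m - s).
    have : rho * (m - s) <= d x y * (m - s) by rewrite ler_wpM2r // subr_ge0 ltW.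
    by clear E; move: e0; lra.
  by clear E; lra.
rewrite -lee_fin -E /gslope /=.
apply: (@le_trans _ _ (maxe ((chain_inf x)%:E - (chain_inf y)%:E) 0 * ((d x y)^-1)%:E)%E).
  rewrite -EFinB -EFin_max -EFinM lee_fin ler_wpM2r ?invr_ge0 ?met_ge0 //.
  by rewrite le_max lexx.
apply: ereal_sup_ubound; right; exists y; split => // yx.
by move: dxy; rewrite yx met_xx ltxx.
Qed.

Lemma chain_inf_solution : mlsc d l -> is_solution d l (EFin \o chain_inf).
Proof.
move=> llsc; split.
- exact: chain_inf_lsc.
- apply/le_anti/andP; split.
    have [z lz] := zl.
    by apply: ereal_inf_lbound; exists z => //=; rewrite chain_inf0.
  by apply: le_ereal_inf_tmp => _ [x _ <-]; rewrite lee_fin chain_inf_ge0.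
- by move=> x; apply/le_anti; rewrite gslope_chain_inf_le gslope_chain_inf_ge.
Qed.

(** The slope inequality telescopes along a chain, whose last point contributes at most 0. *)
Lemma solution_le_chain_inf u x : is_solution d l u -> (u x <= (chain_inf x)%:E)%E.
Proof.
move=> [_ uinf us].
have u0 y : (0 <= u y)%E by rewrite -uinf; apply: ereal_inf_lbound; exists y.
(* An infinite value would have slope [+oo], whereas [l] is real-valued. *)
have ufin y : u y \is a fin_num.
  rewrite fin_numElt (lt_le_trans _ (u0 y)) //= ltey.
  by apply/eqP => uy; have := us y; rewrite /gslope uy eqxx.
pose U := fine \o u; have uE y : u y = (U y)%:E by rewrite fineK.
have Ustep y z : U y <= l y * d y z + U z.
  have [->|zy] := pselect (z = y); first by rewrite met_xx mulr0 add0r.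
  have dyz : 0 < d y z by apply: met_gt0 => yz; apply: zy.
  rewrite -lerBlDr -ler_pdivrMr // -lee_fin -(us y) /gslope uE /=.
  apply: (@le_trans _ _ (maxe (u y - u z) 0 * ((d y z)^-1)%:E)%E).
    rewrite !uE -EFinB -EFin_max -EFinM lee_fin ler_wpM2r ?invr_ge0 ?met_ge0 //.
    by rewrite le_max lexx.
  by apply: ereal_sup_ubound; right; exists z; rewrite !uE.
(* At a zero of [l] the slope inequality reads [U z <= U y] for all [y], so [U z] is at most the
   infimum 0. *)
have U0 z : l z = 0 -> U z <= 0.
  move=> lz; have : (u z <= ereal_inf (range u))%E; last by rewrite uinf uE lee_fin.
  apply: le_ereal_inf_tmp => _ [y _ <-].
  by rewrite !uE lee_fin (le_trans (Ustep z y)) // lz mul0r add0r.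
have Uchain k p : l (p k) = 0 -> U (p 0%N) <= chain_cost p k.
  elim: k p => [|k IH] p lk; first by rewrite /chain_cost big_ord0 U0.
  rewrite chain_cost_recl (le_trans (Ustep _ (p 1%N))) // lerD2l.
  exact: (IH (p \o succn)).
rewrite uE lee_fin; apply: lb_le_inf; first by case: (chain_costs_has_inf x).
by move=> _ [k [p [<- lk ->]]]; exact: Uchain.
Qed.

Lemma perron_chain_inf u : mlsc d l -> is_perron d l u ->
  u = EFin \o chain_inf.
Proof.
move=> llsc [us umax]; apply/funext => x; apply/le_anti.
by rewrite solution_le_chain_inf //=; exact: (umax _ (chain_inf_solution llsc)).
Qed.

Lemma vR_nonincreasing x : {homo (fun r => vR d l r x) : r s / r <= s >-> (s <= r)%E}.
Proof.
move=> r s rs; apply: ereal_inf_le_tmp => _ [k [p [px lk pr ->]]].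
by exists k, p; split => // i ik; apply: lt_le_trans (pr i ik) rs.
Qed.

(** A chain has finitely many steps, so it is admissible for all large [r]. *)
Lemma inf_vR x : ereal_inf (range (fun r => vR d l r x)) = (chain_inf x)%:E.
Proof.
apply/le_anti/andP; split.
  apply/lee_addgt0Pr => e e0; have [k [p [px lk h]]] := chain_inf_approx x e0.
  apply: (@le_trans _ _ (chain_cost p k)%:E); last by rewrite -EFinD lee_fin ltW.
  (* The total length plus 1 strictly exceeds every single step. *)
  pose r := \sum_(i < k) d (p i) (p i.+1) + 1.
  apply: (@le_trans _ _ (vR d l r x)); first by apply: ereal_inf_lbound; exists r.
  apply: ereal_inf_lbound; exists k, p; split => // i ik.
  rewrite /r (bigD1 (Ordinal ik)) //= -addrA ltr_pwDr //.
  by rewrite ltr_wpDl // sumr_ge0 // => j _; exact: met_ge0.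
apply: le_ereal_inf_tmp => _ [r _ <-]; apply: le_ereal_inf_tmp => _ [k [p [<- lk _ ->]]].
by rewrite lee_fin; exact: chain_inf_le.
Qed.

Lemma vR_cvg_perron u x : mlsc d l -> is_perron d l u ->
  vR d l r x @[r --> +oo%R] --> u x.
Proof.
move=> llsc uP; rewrite (perron_chain_inf llsc uP) /= -inf_vR.
exact: nonincreasing_cvge (@vR_nonincreasing x).
Qed.
End Chains.

(** * Curves and Riemann sums *)

Section Curves.
Context {R : realType} {X : Type} (d : X -> X -> R) (l : X -> R).
Hypotheses (dm : is_metric d) (l0 : forall x, 0 <= l x).
Implicit Types (x y z : X) (p : nat -> X) (k : nat) (g : R -> X) (T : R).
Local Notation mu := (@lebesgue_measure R).

Lemma lip1_cont_on g T : mcontinuous d l -> lip1 d g T -> cont_on (l \o g) 0 T.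
Proof.
move=> lc gl t tT e e0; have [del del0 H] := lc (g t) e e0.
exists del => // s sT st; rewrite distrC; apply: H.
by apply: le_lt_trans (gl t s tT sT) _; rewrite distrC.
Qed.

Lemma chain_cost_recr p k :
  chain_cost d l p k.+1 = chain_cost d l p k + l (p k) * d (p k) (p k.+1).
Proof. by rewrite /chain_cost big_ord_recr. Qed.

(** Sampling [g] with mesh [h] gives a chain with steps at most [h]. Uniform continuity of [l] along
    [g] bounds the excess of its cost over the integral by [e' * T]. *)
Lemma vR_le_integral r g T : mcontinuous d l -> 0 < r -> 0 <= T -> lip1 d g T ->
  l (g T) = 0 -> (vR d l r (g 0%R) <= \int[mu]_(t in `[0%R, T]) (l (g t))%:E)%E.
Proof.
move=> lc r0 T0 gl lT; have fc := lip1_cont_on lc gl.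
apply/lee_addgt0Pr => e e0.
(* [T] may be 0, so the error allowed per unit of time is [e / (T + 1)]. *)
have T1 : 0 < T + 1 by rewrite ltr_wpDl.
pose e' := e / (T + 1); have e'0 : 0 < e' by rewrite divr_gt0.
have [del del0 H] := cont_on_unif e'0 fc.
pose m := Num.min r del; have m0 : 0 < m by rewrite lt_min r0 del0.
(* Enough equal intervals to bring the mesh below both [r] and [del]. *)
pose n := Num.bound (T / m); pose h := T / n.+1%:R.
have h0 : 0 <= h by rewrite divr_ge0.
have hm : h < m.
  rewrite /h ltr_pdivrMr ?ltr0n // mulrC -ltr_pdivrMr //.
  apply: lt_trans (archi_boundP _) _; first by rewrite divr_ge0 // ltW.
  by rewrite ltr_nat.
have [hr hdel] : h < r /\ h < del by move: hm; rewrite lt_min => /andP.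
have hn : n.+1%:R * h = T by rewrite /h mulrC divfK.
have hin i : (i <= n.+1)%N -> 0 <= i%:R * h <= T.
  by move=> i_n; rewrite mulr_ge0 //= -[leRHS]hn ler_wpM2r // ler_nat.
have hS (i : nat) : i.+1%:R * h = i%:R * h + h by rewrite -natr1 mulrDl mul1r.
pose p i := g (i%:R * h).
have pd i : (i < n.+1)%N -> d (p i) (p i.+1) <= h.
  move=> i_n; apply: le_trans (gl _ _ (hin _ (ltnW i_n)) (hin _ i_n)) _.
  by rewrite hS opprD addrA subrr sub0r normrN ger0_norm.
have key i : (i <= n.+1)%N -> ((chain_cost d l p i)%:E <=
    \int[mu]_(t in `[0%R, (i%:R * h)%R]) (l (g t))%:E + (e' * (i%:R * h))%:E)%E.
  elim: i => [|i IH] i_n.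
    rewrite /chain_cost big_ord0 mul0r mulr0 adde0.
    by apply: ge0_integral_segment => t _; exact: l0.
  have ih := hin _ (ltnW i_n); have ih1 := hin _ i_n.
  have ab : i%:R * h <= i.+1%:R * h by rewrite hS lerDl.
  have a0 : 0 <= i%:R * h by case/andP: ih.
  have fc1 : cont_on (l \o g) 0 (i.+1%:R * h).
    by apply: cont_on_sub fc => //; case/andP: ih1.
  rewrite (@integral_segment_split _ (l \o g) (i%:R * h)) //; last first.
    by move=> t _; exact: l0.
  rewrite chain_cost_recr.
  (* A lower bound for [l] on this interval, truncated at 0 because [integral_oc_ge] takes a
     nonnegative constant. *)
  pose c := Num.max (l (p i) - e') 0.
  have h1 : ((c * (i.+1%:R * h - i%:R * h))%:E <=
      \int[mu]_(t in `](i%:R * h)%R, (i.+1%:R * h)%R]) ((l \o g) t)%:E)%E.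
    apply: integral_oc_ge => //.
    - by apply: cont_on_sub fc; [case/andP: ih | case/andP: ih1].
    - by rewrite /c le_max lexx orbT.
    - move=> t /andP[ta tb]; rewrite /c ge_max l0 andbT.
      have tT : 0 <= t <= T.
        by case/andP: ih => ? _; case/andP: ih1 => _ ?; apply/andP; split; lra.
      have : `|l (g (i%:R * h)) - l (g t)| < e'.
        apply: H => //; rewrite ler0_norm; last by lra.
        by move: tb; rewrite hS; lra.
      by move=> /ltr_normlW; rewrite /p /=; lra.
  have h2 : l (p i) * d (p i) (p i.+1) <= c * h + e' * h.
    apply: (@le_trans _ _ (l (p i) * h)); first by rewrite ler_wpM2l // pd.
    rewrite -mulrDl ler_wpM2r // -lerBlDr /c le_max lexx //.
  have h3 := leeD (IH (ltnW i_n)) (leeD h1 (lexx (e' * h)%:E)).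
  rewrite hS in h3 *.
  move: h3; set I1 := (X in (_ <= X + _ + _)%E -> _).
  set I2 := (X in (_ <= _ + (X + _))%E -> _) => h3.
  have -> : (I1 + I2 + (e' * (i%:R * h + h))%:E =
      I1 + (e' * (i%:R * h))%:E + (I2 + (e' * h)%:E))%E.
    by rewrite addeACA -EFinD mulrDr.
  apply: le_trans h3; rewrite -!EFinD lee_fin.
  have -> : i%:R * h + h - i%:R * h = h by ring.
  by rewrite lerD2l.
apply: (@le_trans _ _ (chain_cost d l p n.+1)%:E).
  apply: ereal_inf_lbound; exists n.+1, p; split => //.
  - by rewrite /p mul0r.
  - by rewrite /p hn.
  - by move=> i i_n; apply: le_lt_trans (pd _ i_n) hr.
apply: le_trans (key n.+1 (leqnn _)) _.
rewrite hn leeD2l // lee_fin /e' mulrAC ler_pdivrMr // ler_pM2l //; lra.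
Qed.

Lemma vR_le_Vfun r x : mcontinuous d l -> 0 < r -> (vR d l r x <= Vfun d l x)%E.
Proof.
move=> lc r0; apply: le_ereal_inf_tmp => _ [T [g [T0 gl <- lT ->]]].
by rewrite segmentE; exact: vR_le_integral.
Qed.

Lemma liminf0_vR_le_Vfun x : mcontinuous d l ->
  (liminf0 (fun r => vR d l r x) <= Vfun d l x)%E.
Proof.
move=> lc; apply: ge_ereal_sup => _ [del del0 ->].
apply: (@le_trans _ _ (vR d l (del / 2) x)); last by apply: vR_le_Vfun => //; lra.
by apply: ereal_inf_lbound; exists (del / 2) => //=; apply/andP; split; lra.
Qed.

(** The endpoint is free and [c] only bounds the cost, so that bounds add up when curves are
    concatenated. *)
Definition reachable x y (c : R) := exists (T : R) (g : R -> X),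
  [/\ 0 <= T, lip1 d g T, g 0 = x, g T = y
    & (\int[mu]_(t in `[0%R, T]) (l (g t))%:E <= c%:E)%E].

Lemma reachable_refl x : reachable x x 0.
Proof.
exists 0, (fun=> x); split => // [s t _ _|]; first by rewrite met_xx.
by rewrite set_itv1 integral_set1.
Qed.

Lemma Vfun_le_reachable x y c : l y = 0 -> reachable x y c -> (Vfun d l x <= c%:E)%E.
Proof.
move=> ly [T [g [T0 gl gx gy gc]]]; apply: le_trans gc; apply: ereal_inf_lbound.
by exists T, g; rewrite segmentE; split => //; rewrite gy.
Qed.

Lemma reachable_append x y z c B D (q : R -> X) : mcontinuous d l -> 0 <= D ->
  lip1 d q D -> q 0 = y -> q D = z -> (forall t, 0 <= t <= D -> l (q t) <= B) ->
  reachable x y c -> reachable x z (c + B * D).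
Proof.
move=> lc D0 ql qy qz qB [T [g [T0 gl gx gy gc]]].
pose g' t := if t <= T then g t else q (t - T).
have g'l : lip1 d g' (T + D).
  (* By symmetry [s <= t] suffices; across the junction, pass through [g T], which is [q 0]. *)
  have half s t : s <= t -> 0 <= s <= T + D -> 0 <= t <= T + D ->
      d (g' s) (g' t) <= t - s.
    move=> st /andP[s0 sT] /andP[t0 tT]; rewrite /g'.
    have [tT'|tT'] := leP t T; have [sT'|sT'] := leP s T; try lra.
    - have := gl s t; rewrite distrC ger0_norm ?subr_ge0 //; apply.
        by rewrite s0 sT'.
      by rewrite t0 tT'.
    - apply: le_trans (met_tri dm (g T) _ _) _.
      have h1 : d (g s) (g T) <= `|s - T|.
        by apply: gl; [rewrite s0 sT' | rewrite T0 lexx].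
      have h2 : d (g T) (q (t - T)) <= `|0 - (t - T)|.
        rewrite gy -qy; apply: ql; first by rewrite lexx D0.
        by apply/andP; split; lra.
      move: h1 h2; rewrite distrC ger0_norm ?subr_ge0 //.
      by rewrite sub0r normrN gtr0_norm ?subr_gt0 //; lra.
    - have := ql (s - T) (t - T); have -> : s - T - (t - T) = s - t by ring.
      rewrite distrC ger0_norm ?subr_ge0 //; apply; apply/andP; split; lra.
  move=> s t sT tT; have [st|ts] := leP s t.
    by rewrite distrC ger0_norm ?subr_ge0 //; exact: half.
  by rewrite gtr0_norm ?subr_gt0 // (met_sym dm); apply: half => //; exact: ltW.
exists (T + D), g'; split => //.
- by rewrite addr_ge0.
- by rewrite /g' T0.
(* The time [T + D] falls in the first branch only if [D = 0], and then [q] is a single point. *)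
- rewrite /g'; case: leP => [TD|_]; last by have -> : T + D - T = D by ring.
  have D00 : D = 0 by lra.
  by rewrite D00 addr0 gy -qy -qz D00.
have fc := lip1_cont_on lc g'l.
have TTD : T <= T + D by rewrite lerDl.
rewrite (@integral_segment_split _ (l \o g') T) //; last by move=> t _; exact: l0.
rewrite EFinD leeD //.
  apply: le_trans gc; rewrite le_eqVlt; apply/orP; left; apply/eqP.
  apply: eq_integral => t; rewrite inE /= in_itv /= => /andP[_ tT].
  by rewrite /g' tT.
have -> : B * D = B * (T + D - T) by ring.
apply: integral_oc_le => //; first exact: cont_on_sub fc.
move=> t /andP[Tt tD] /=; rewrite l0 /= /g' (leNgt t T) Tt /=.
by apply: qB; apply/andP; split; lra.
Qed.
End Curves.

(** * Geodesics and compactness *)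

Section Geodesics.
Context {R : realType} {X : Type} (d : X -> X -> R).
Hypothesis dm : is_metric d.
Implicit Types (x y z : X) (g : R -> X).

Lemma mopen_ball x e : mopen d [set y | d x y < e].
Proof.
move=> y /= xy; exists (e - d x y) => [|z yz]; first by rewrite subr_gt0.
by apply: le_lt_trans (met_tri dm y _ _) _; lra.
Qed.

Lemma dist_cont_on x g a b : curve_cont d g a b -> cont_on (fun t => d x (g t)) a b.
Proof.
move=> gc t tab e e0; have [del del0 H] := gc t tab e e0.
exists del => // s sab st; apply: le_lt_trans (H s sab st).
have h1 := met_tri dm (g t) x (g s); have h2 := met_tri dm (g s) x (g t).
rewrite (met_sym dm (g t) (g s)) in h1 *.
by rewrite ler_norml; apply/andP; split; lra.
Qed.

Lemma curve_length_ge3 g a b s t : a <= s -> s <= t -> t <= b ->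
  ((d (g a) (g s) + d (g s) (g t) + d (g t) (g b))%:E <= curve_length d g a b)%E.
Proof.
move=> as_ st tb; apply: ereal_sup_ubound; exists 3%N, (nth b [:: a; s; t; b]).
split => //; first by case=> [|[|[|]]].
by rewrite !big_ord_recl big_ord0 /= addr0 addrA.
Qed.

(* Along a curve of length at most [d x y + e], choosing a point at each distance
   from [x] gives an almost isometric (in general discontinuous) parametrization. *)
Lemma almost_geodesic x y e : length_space d -> 0 < e -> exists q : R -> X,
  [/\ q 0 = x, d (q (d x y)) y <= e &
    forall s t, 0 <= s <= d x y -> 0 <= t <= d x y -> d (q s) (q t) <= `|s - t| + e].
Proof.
move=> dl e0.
have d0 : 0 <= d x y by exact: met_ge0.
have : ((d x y)%:E < (d x y + e)%:E)%E by rewrite lte_fin ltrDl.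
rewrite dl => /ereal_inf_lt [_ [a [b [g [ab gc ga gb ->]]]] Lxy].
have short s t : a <= s -> s <= t -> t <= b ->
    d x (g s) + d (g s) (g t) + d (g t) y <= d x y + e.
  move=> as_ st tb; rewrite -lee_fin; apply: le_trans (ltW Lxy).
  by rewrite -{1}ga -{1}gb; exact: curve_length_ge3.
(* [sg v] is a time at which the curve is at distance [v] from [x], by the intermediate value
   theorem; [a] is the default outside the range. *)
have /choice [sg sgP] : forall v, exists c, 0 <= v <= d x y ->
    (a <= c <= b) /\ d x (g c) = v.
  move=> v; have [vd|] := boolP (0 <= v <= d x y); last by exists a.
  have [||c cab cv] := @IVT R (fun t => d x (g t)) a b v ab.
  - exact/cont_on_within/dist_cont_on.
  - by rewrite ga gb (met_xx dm) (min_l d0) (max_r d0).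
  - by exists c => _; move: cab; rewrite in_itv.
have D0 : (0 <= 0 :> R) && (0 <= d x y) by rewrite d0 andbT.
have DD : 0 <= d x y <= d x y by rewrite d0 lexx.
exists (g \o sg); split => /=.
- have [_ h] := sgP _ D0; apply/esym; case: dm => _ H _ _; exact/H.
- have [/andP[h1 h2] h3] := sgP _ DD.
  by have := short _ _ h1 (lexx _) h2; rewrite h3 (met_xx dm) addr0 lerD2l.
(* The length bound gives [s + d (q s) (q t) + d (q t) y <= d x y + e], where
   [d (q t) y >= d x y - t]. *)
- have ordered s t : 0 <= s <= d x y -> 0 <= t <= d x y -> sg s <= sg t ->
      d (g (sg s)) (g (sg t)) <= `|s - t| + e.
    move=> sD tD st; have [/andP[s1 s2] s3] := sgP _ sD.
    have [/andP[t1 t2] t3] := sgP _ tD.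
    have := short _ _ s1 st t2; rewrite s3 => h.
    have := met_tri dm (g (sg t)) x y; rewrite t3.
    have := ler_norm (t - s); rewrite distrC; lra.
  move=> s t sD tD; have [st|ts] := leP (sg s) (sg t); first exact: ordered.
  by rewrite (met_sym dm) distrC; apply: ordered => //; exact: ltW.
Qed.

(** Otherwise every point has a ball that [f] avoids on a set of [U]; for a finite subcover these
    sets meet, at an index [n] for which [f n] lies in no ball. *)
Lemma ultra_limit (U : set_system nat) (f : nat -> X) : mcompact d -> UltraFilter U ->
  exists x, forall e : R, 0 < e -> U [set n | d x (f n) < e].
Proof.
move=> cX uU; apply: contrapT => H.
have /choice [r rP] : forall x, exists e : R, 0 < e /\ ~ U [set n | d x (f n) < e].
  move=> x; apply: contrapT => Hx; apply: H; exists x => e e0.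
  by apply: contrapT => K; apply: Hx; exists e.
have [||N [c cP]] := cX X (fun x => [set y | d x y < r x]).
- by move=> x; exact: mopen_ball.
- by move=> x; exists x => /=; rewrite (met_xx dm); case: (rP x).
have far N' : U [set n | forall k, (k < N')%N -> ~ d (c k) (f n) < r (c k)].
  elim: N' => [|N' IH]; first by apply: filterS filterT => n _ k.
  have [|far'] := in_ultra_setVsetC [set n | d (c N') (f n) < r (c N')] uU.
    by case: (rP (c N')) => _ /[apply].
  apply: filterS (filterI IH far') => n [h1 h2] k.
  by rewrite ltnS leq_eqVlt => /orP[/eqP -> //|]; exact: h1.
have [n nP] := filter_ex (far N).
by have [k kN] := cP (f n); exact: nP.
Qed.

Lemma compact_geodesic x y : mcompact d -> length_space d ->
  exists q : R -> X, [/\ lip1 d q (d x y), q 0 = x & q (d x y) = y].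
Proof.
move=> cX dl; pose r (n : nat) : R := n.+1%:R^-1.
have r0 n : 0 < r n by rewrite invr_gt0.
have /choice [q qP] : forall n, exists q : R -> X,
    [/\ q 0 = x, d (q (d x y)) y <= r n &
    forall s t, 0 <= s <= d x y -> 0 <= t <= d x y -> d (q s) (q t) <= `|s - t| + r n].
  by move=> n; exact: almost_geodesic.
have [U [uU leU]] := @ultraFilterLemma nat \oo _.
have small e : 0 < e -> U [set n | r n < e].
  by move=> e0; apply: leU; exact: near_infty_natSinv_lt (PosNum e0).
(* A single ultrafilter serves all parameters [t] at once, so inequalities between several values of
   [q n] pass to the limit. *)
have /choice [p pP] := fun t => ultra_limit (q ^~ t) cX uU.
have d0 : 0 <= d x y by exact: met_ge0.
have d_eq0 u v : (forall e, 0 < e -> d u v <= e) -> u = v.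
  move=> H; case: dm => _ K _ _; apply/K/le_anti; rewrite (met_ge0 dm) andbT.
  by apply/ler_addgt0Pr => e e0; rewrite add0r H.
exists p; split.
- move=> s t sD tD; apply/ler_addgt0Pr => e e0.
  have e3 : 0 < e / 3 by lra.
  have [n [[/= h1 h2] h3]] := filter_ex (filterI (filterI (pP s _ e3) (pP t _ e3)) (small _ e3)).
  have [_ _ /(_ s t sD tD) h4] := qP n.
  have := met_tri dm (q n s) (p s) (p t).
  have := met_tri dm (q n t) (q n s) (p t).
  by rewrite (met_sym dm (q n t) (p t)); lra.
- apply: d_eq0 => e e0; have [n /= h] := filter_ex (pP 0 _ e0).
  by have [qx _ _] := qP n; rewrite -qx ltW.
- apply: d_eq0 => e e0; have e3 : 0 < e / 2 by lra.
  have [n [/= h1 h3]] := filter_ex (filterI (pP (d x y) _ e3) (small _ e3)).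
  have [_ h4 _] := qP n.
  have := met_tri dm (q n (d x y)) (p (d x y)) y; lra.
Qed.
End Geodesics.

(** * Uniform estimates from compactness *)

Section Compactness.
Context {R : realType} {X : Type} (d : X -> X -> R) (l : X -> R).
Hypotheses (dm : is_metric d) (cX : mcompact d).
Implicit Types (x y z : X).

(** The largest set of a finite subcover contains the others. Below, [U n] collects the points at
    which a constant indexed by [n] works, and the lemma makes it uniform. *)
Lemma compact_increasing_cover (U : nat -> set X) : (forall n, mopen d (U n)) ->
  (forall m n x, (m <= n)%N -> U m x -> U n x) -> (forall x, exists n, U n x) ->
  exists n, forall x, U n x.
Proof.
move=> oU incU cU; have [N [f fP]] := cX oU cU.
exists (\max_(k < N) f k)%N => x; have [k kN ux] := fP x.
by apply: incU ux; exact: (@leq_bigmax _ (fun k : 'I_N => f k) (Ordinal kN)).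
Qed.

Lemma inv_natS_le (m n : nat) : (m <= n)%N -> n.+1%:R^-1 <= m.+1%:R^-1 :> R.
Proof. by move=> mn; rewrite lef_pV2 ?posrE // ler_nat. Qed.

Lemma inv_natS_lt (e : R) : 0 < e -> exists n : nat, n.+1%:R^-1 < e.
Proof.
move=> e0; exists (Num.bound e^-1); rewrite -[ltRHS]invrK ltf_pV2 ?posrE ?invr_gt0 //.
apply: lt_trans (archi_boundP _) _; first by rewrite invr_ge0 ltW.
by rewrite ltr_nat.
Qed.

Lemma mcontinuous_lt (f : X -> R) c x : mcontinuous d f -> f x < c ->
  exists2 e : R, 0 < e & forall y, d x y < e -> f y < c.
Proof.
move=> fc fx; have [|del del0 H] := fc x (c - f x); first by rewrite subr_gt0.
exists del => // y xy; have := H y xy; rewrite distrC => /ltr_normlW; lra.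
Qed.

Lemma mcontinuous_gt (f : X -> R) c x : mcontinuous d f -> c < f x ->
  exists2 e : R, 0 < e & forall y, d x y < e -> c < f y.
Proof.
move=> fc fx; have [|del del0 H] := fc x (f x - c); first by rewrite subr_gt0.
exists del => // y xy; have := H y xy => /ltr_normlW; lra.
Qed.

Lemma compact_bounded (f : X -> R) : mcontinuous d f ->
  exists2 M : R, 0 < M & forall x, f x <= M.
Proof.
move=> fc; have [|||n nP] := @compact_increasing_cover (fun n => [set x | f x < n.+1%:R]).
- by move=> n x /(mcontinuous_lt fc).
- by move=> m n x mn /= h; apply: lt_le_trans h _; rewrite ler_nat.
- move=> x; exists (Num.bound `|f x|) => /=.
  apply: le_lt_trans (ler_norm _) _; apply: lt_trans (archi_boundP _) _ => //.
  by rewrite ltr_nat.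
- by exists n.+1%:R => // x; exact/ltW/nP.
Qed.

Lemma dist_mcontinuous x : mcontinuous d (d x).
Proof.
move=> y e e0; exists e => // z yz; apply: le_lt_trans yz.
have h1 := met_tri dm y x z; have h2 := met_tri dm z x y.
rewrite (met_sym dm z y) in h2.
by rewrite ler_norml; apply/andP; split; lra.
Qed.

Lemma compact_near_zero rho : mcontinuous d l -> (forall x, 0 <= l x) -> 0 < rho ->
  exists2 eta : R, 0 < eta &
    forall x, l x < eta -> exists2 z, l z = 0 & d x z < rho.
Proof.
move=> lc l0 rho0.
have [|||n nP] := @compact_increasing_cover
  (fun n => [set x | n.+1%:R^-1 < l x \/ exists2 z, l z = 0 & d x z < rho]).
- move=> n x [/(mcontinuous_gt lc) [e e0 H]|[z lz xz]].
    by exists e => // y /H; left.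
  exists (rho - d x z) => [|y xy]; first by rewrite subr_gt0.
  right; exists z => //; have := met_tri dm x y z.
  by rewrite (met_sym dm y x); lra.
- move=> m n x mn [h|]; [left | by right].
  exact: le_lt_trans (inv_natS_le mn) h.
- move=> x; have [lx|lx] := ltP 0 (l x).
    by have [n h] := inv_natS_lt lx; exists n; left.
  exists 0%N; right; exists x; last by rewrite (met_xx dm).
  by apply/le_anti; rewrite lx l0.
- exists n.+1%:R^-1 => // x lx; have [h|//] := nP x.
  by have := lt_trans lx h; rewrite ltxx.
Qed.

Lemma compact_unif_continuous om : mcontinuous d l -> 0 < om ->
  exists2 del : R, 0 < del & forall x y, d x y < del -> `|l x - l y| < om.
Proof.
move=> lc om0.
have [|||n nP] := @compact_increasing_cover (fun n => [set x | exists2 s : R,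
  n.+1%:R^-1 < s & forall y z, d x y < s -> d x z < s -> `|l y - l z| < om]).
(* The strict inequality leaves room for a midpoint [s']: centres within [s - s'] of [x] inherit the
   property with radius [s']. *)
- move=> n x [s ns H]; have [ns' s's] := midf_lt ns.
  set s' := _ / 2 in ns' s's.
  exists (s - s') => [|y xy]; first by rewrite subr_gt0.
  exists s' => // u v yu yv.
  by apply: H; apply: le_lt_trans (met_tri dm y _ _) _; move: xy yu yv; clearbody s'; lra.
- move=> m n x mn [s ms H]; exists s => //.
  exact: le_lt_trans (inv_natS_le mn) ms.
- move=> x; have [|s s0 H] := lc x (om / 2); first by lra.
  have [n ns] := inv_natS_lt s0; exists n; exists s => // y z /H h1 /H h2.
  have := ler_normB (l x - l z) (l x - l y).
  have -> : l x - l z - (l x - l y) = l y - l z by ring.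
  lra.
- exists n.+1%:R^-1 => // x y xy; have [s ns H] := nP x.
  by apply: H; [rewrite (met_xx dm); apply: lt_trans ns | exact: lt_trans ns].
Qed.
End Compactness.

(** * From chains to curves in a compact length space *)

Section CompactLengthSpace.
Context {R : realType} {X : Type} (d : X -> X -> R) (l : X -> R).
Hypotheses (dm : is_metric d) (l0 : forall x, 0 <= l x) (lc : mcontinuous d l).
Hypotheses (cX : mcompact d) (dl : length_space d).
Implicit Types (x y z : X) (p : nat -> X).

(** A geodesic from [y] to [z] stays within [d y z] of [y], so a bound of [l] there controls the
    added cost. *)
Lemma reachable_geodesic x y z c B :
  (forall w, d y w <= d y z -> l w <= B) ->
  reachable d l x y c -> reachable d l x z (c + B * d y z).
Proof.
move=> lB; have [q [ql qy qz]] := compact_geodesic dm y z cX dl.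
apply: (reachable_append dm l0 lc _ ql qy qz) => //; first exact: met_ge0.
move=> t tD; apply: lB; have /andP[t0 tyz] := tD.
have := ql 0 t; rewrite qy sub0r normrN ger0_norm // => h.
by apply: le_trans tyz; apply: h => //; rewrite lexx (met_ge0 dm).
Qed.

(* The error [om * d] of one step is absorbed into the relative error [kap * l * d]
   as long as [l >= eta]; once [l < eta], a zero of [l] is within [rho] and the rest
   of the chain is replaced by a single geodesic. *)
Lemma Vfun_le_chain_cost M rho eta kap del p k x c :
  (forall y, l y <= M) -> 0 <= M -> 0 < rho -> 0 < eta -> 0 < kap ->
  (forall y, l y < eta -> exists2 z, l z = 0 & d y z < rho) ->
  (forall y z, d y z < del -> `|l y - l z| < kap * eta) ->
  (forall i, (i < k)%N -> d (p i) (p i.+1) < del) -> l (p k) = 0 ->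
  reachable d l x (p 0%N) c ->
  (Vfun d l x <= (c + (1 + kap) * chain_cost d l p k + M * rho)%:E)%E.
Proof.
move=> lM M0 rho0 eta0 kap0 Heta Hdel.
have kap1 : 0 <= 1 + kap by lra.
(* The abandoned chain [p'] has nonnegative cost, so its term may stay in the bound. *)
have stop p' k' y c' : l y < eta -> reachable d l x y c' ->
    (Vfun d l x <= (c' + (1 + kap) * chain_cost d l p' k' + M * rho)%:E)%E.
  move=> ly ry; have [z lz yz] := Heta _ ly.
  have rz := reachable_geodesic (B := M) (z := z) (fun w _ => lM w) ry.
  apply: le_trans (Vfun_le_reachable lz rz) _.
  rewrite lee_fin -addrA lerD2l -[leLHS]add0r lerD //.
    by rewrite mulr_ge0 // chain_cost_ge0.
  by rewrite ler_wpM2l // ltW.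
elim: k p c => [|k IH] p c pd lk rc.
  by apply: stop rc; rewrite lk.
have [lp|lp] := ltP (l (p 0%N)) eta; first exact: stop rc.
have d0 := met_ge0 dm (p 0%N) (p 1%N).
have r1 : reachable d l x (p 1%N) (c + (l (p 0%N) + kap * eta) * d (p 0%N) (p 1%N)).
  apply: reachable_geodesic rc => w pw.
  have := Hdel _ _ (le_lt_trans pw (pd 0%N isT)).
  by rewrite distrC => /ltr_normlW; lra.
apply: le_trans (IH (p \o succn) _ _ lk r1) _.
  by move=> i ik; exact: pd.
rewrite lee_fin chain_cost_recl lerD2r mulrDr addrA lerD2r lerD2l.
by rewrite mulrA ler_wpM2r // mulrDl mul1r lerD2l ler_wpM2l // ltW.
Qed.

Lemma Vfun_le_vR_unif e : 0 < e -> (exists z, l z = 0) ->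
  exists2 del : R, 0 < del & forall r, 0 < r < del -> forall x,
    (Vfun d l x <= vR d l r x + e%:E)%E.
Proof.
move=> e0 [z lz].
have [M M0 lM] := compact_bounded cX lc.
have [D D0 dD] := compact_bounded cX (dist_mcontinuous dm z).
(* One geodesic to the fixed zero [z] bounds [V], hence [v_R], uniformly; the relative error [kap]
   thus becomes a uniform absolute one. *)
have VC x : (Vfun d l x <= (M * D)%:E)%E.
  have := Vfun_le_reachable lz (reachable_geodesic (B := M) (z := z) (fun w _ => lM w)
    (reachable_refl l dm x)).
  rewrite add0r => h; apply: le_trans h _.
  by rewrite lee_fin ler_wpM2l ?(ltW M0) // (met_sym dm).
(* The final geodesic, the factor [1 + kap] and the choice of an almost optimal chain ([tau] below)
   each cost at most [e / 4]. *)
pose rho := e / (4 * M); have rho0 : 0 < rho by rewrite divr_gt0 // mulr_gt0.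
pose kap := e / (4 * (M * D)); have kap0 : 0 < kap.
  by rewrite divr_gt0 // mulr_gt0 // mulr_gt0.
have Mrho : M * rho = e / 4 by rewrite /rho; field; rewrite gt_eqF.
have kapC : kap * (M * D) = e / 4 by rewrite /kap; field; rewrite !gt_eqF.
have [eta eta0 Heta] := compact_near_zero dm cX lc l0 rho0.
have [del del0 Hdel] := compact_unif_continuous dm cX lc (mulr_gt0 kap0 eta0).
exists del => // r /andP[r0 rdel] x.
have vC : (vR d l r x <= (M * D)%:E)%E by apply: le_trans (VC x); exact: vR_le_Vfun.
have v0 : (0 <= vR d l r x)%E.
  by apply: le_ereal_inf_tmp => _ [k [p [_ _ _ ->]]]; rewrite lee_fin;
    exact: (chain_cost_ge0 dm l0).
case E : (vR d l r x) vC v0 => [v| |] //; rewrite !lee_fin => vC v0.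
pose tau := e / (4 * (1 + kap)); have tau0 : 0 < tau.
  by rewrite divr_gt0 // mulr_gt0 // ltr_wpDl.
have ktau : (1 + kap) * tau = e / 4.
  by rewrite /tau; field; rewrite gt_eqF // ltr_wpDl.
have : (vR d l r x < (v + tau)%:E)%E by rewrite E lte_fin ltrDl.
move=> /ereal_inf_lt [_ [k [p [px lk pr ->]]]]; rewrite lte_fin => h.
have rx : reachable d l x (p 0%N) 0 by rewrite px; exact: reachable_refl.
apply: le_trans (Vfun_le_chain_cost (M := M) lM (ltW M0) rho0 eta0 kap0 Heta Hdel _ lk rx) _.
  by move=> i ik; apply: lt_trans (pr i ik) rdel.
rewrite -EFinD lee_fin add0r Mrho.
have h1 : (1 + kap) * chain_cost d l p k <= (1 + kap) * (v + tau).
  by rewrite ler_wpM2l ?ltW // addr_gt0.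
have h2 : kap * v <= kap * (M * D) by rewrite ler_wpM2l // ltW.
have h3 : (1 + kap) * (v + tau) = v + kap * v + (1 + kap) * tau by ring.
by clear E; lra.
Qed.
End CompactLengthSpace.

Theorem theorem6p5 (R : realType) (X : Type) (d : X -> X -> R) (l : X -> R)
    (u0 : X -> \bar R) :
  is_metric d -> (forall x, 0 <= l x) -> mlsc d l -> (exists x, l x = 0) ->
  is_perron d l u0 ->
  [/\ (mconnected d -> forall x, vR d l r x @[r --> +oo%R] --> u0 x),
      (mcomplete d -> length_space d -> mcontinuous d l ->
         forall x, (liminf0 (fun r => vR d l r x) <= Vfun d l x)%E)
    & (mcompact d -> length_space d -> mcontinuous d l ->
         forall e : R, 0 < e -> exists2 del : R, 0 < del &
           forall r, 0 < r < del -> forall x,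
             (vR d l r x <= Vfun d l x + e%:E)%E /\ (Vfun d l x <= vR d l r x + e%:E)%E)].
Proof.
move=> dm l0 llsc zl u0P; split => [_ x|_ _ lc x|cX dl lc e e0].
- exact: vR_cvg_perron.
- exact: liminf0_vR_le_Vfun.
- have [del del0 H] := Vfun_le_vR_unif dm l0 lc cX dl e0 zl.
  exists del => // r rdel x; split; last exact: H.
  have /andP[r0 _] := rdel.
  apply: (@le_trans _ _ (Vfun d l x)); first exact: vR_le_Vfun.
  by rewrite leeDl // lee_fin ltW.
Qed.
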